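(* Let $d\geq 2$ be an integer. Let $C_d^1\subset\mathbb{C}$ be the open pointed cone with vertex $d-1$, angular width $\frac{2\pi}{d}$, and bisecting ray $(d-1,\infty)$, and let $C_d^2\subset\mathbb{C}$ be the open pointed cone with vertex $-d$, angular width $\frac{2\pi}{d}$, and bisecting ray $(-\infty,-d)$. Then for any SNN polynomial $f$ of degree $d$, the set $C_d^1\cup C_d^2$ does not contain a root of $f$.
   Context: For an integer $k$ and a positive integer $d$, $\binom{t+k}{d}$ denotes the polynomial $\frac{(t+k)(t+k-1)\cdots(t+k-d+1)}{d!}$ in $t$. Every polynomial $f$ of degree $d$ over $\mathbb{C}$ can be written uniquely as $f(t)=\sum_{j=0}^d h_j^*\binom{t+d-j}{d}$ with $h_j^*\in\mathbb{C}$ (equivalently $\sum_{t\ge 0}f(t)x^t=\frac{\sum_{j=0}^d h_j^*x^j}{(1-x)^{d+1}}$). A non-zero polynomial $f$ of degree $d$ is called Stanley non-negative (SNN) if $(h_0^*,\ldots,h_d^* )\in(\mathbb{R}_{\ge 0})^{d+1}$. Explicitly, the cones are $C_d^1=\{d-1+re^{i\theta}: r>0,\ |\theta|<\pi/d\}$ and $C_d^2=\{-d-re^{i\theta}: r>0,\ |\theta|<\pi/d\}$. *)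

(* Defs.v *)
From mathcomp Require Import all_boot all_order all_algebra.
From mathcomp Require Import complex.
From mathcomp Require Import classical_sets reals trigo.

Set Implicit Arguments.
Unset Strict Implicit.
Unset Printing Implicit Defensive.

Import GRing.Theory Num.Theory.
Local Open Scope ring_scope.
Local Open Scope complex_scope.
Local Open Scope classical_set_scope.

Definition binpoly (R : realType) (k : int) (d : nat) : {poly R[i]} :=
  (d`!%:R)^-1 *: \prod_(i < d) ('X + (k - i%:Z)%:~R%:P).

Definition is_hstar (R : realType) (d : nat) (f : {poly R[i]})
    (h : 'I_d.+1 -> R[i]) : Prop :=
  f = \sum_(j < d.+1) h j *: binpoly R (d%:Z - j%:Z) d.

(* In the order of R[i], 0 <= z says that z is real and nonnegative. The
   coefficients h are unique, so [exists h] refers to the h*-vector of f. *)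
Definition SNN (R : realType) (d : nat) (f : {poly R[i]}) : Prop :=
  size f = d.+1 /\
  exists h : 'I_d.+1 -> R[i], is_hstar f h /\ forall j, 0 <= h j.

Definition expi (R : realType) (theta : R) : R[i] := cos theta +i* sin theta.

Definition cone1 (R : realType) (d : nat) : set R[i] :=
  [set z : R[i] | exists r theta : R, [/\ 0 < r, `|theta| < pi / d%:R
    & z = d%:R - 1 + r%:C * expi theta]].

Definition cone2 (R : realType) (d : nat) : set R[i] :=
  [set z : R[i] | exists r theta : R, [/\ 0 < r, `|theta| < pi / d%:R
    & z = - d%:R - r%:C * expi theta]].

(* Main.v *)
(** Substituting [t = d - 1 + w], every factor of every binomial polynomial
    becomes [w + c] with [c >= 0], so the SNN polynomial [f] turns into a
    nonzero polynomial in [w] of degree at most [d] with nonnegative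
    coefficients; so does [(-1)^d f] under [t = - d - w]. If [w] has argument
    [theta] with [|theta| < pi / d], the monomials [w^k], [k <= d], all lie in
    the open half-plane centred at the direction [d theta / 2], hence no
    nontrivial nonnegative combination of them vanishes. *)
Require Import Defs.
From mathcomp Require Import all_boot all_order all_algebra.
From mathcomp Require Import complex.
From mathcomp Require Import classical_sets reals trigo.
From mathcomp Require Import ring lra.

Import Order.TTheory GRing.Theory Num.Theory.
Local Open Scope ring_scope.
Local Open Scope complex_scope.
Local Open Scope classical_set_scope.

Lemma expiD (R : realType) (a b : R) : expi (a + b) = expi a * expi b.
Proof. by rewrite /expi cosD sinD; apply/eqP; rewrite eq_complex /= eqxx addrC eqxx. Qed.

Lemma expiX (R : realType) (a : R) (n : nat) : expi a ^+ n = expi (a *+ n).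
Proof.
elim: n => [|n IHn]; first by rewrite mulr0n /expi cos0 sin0.
by rewrite exprS IHn mulrS expiD.
Qed.

Lemma Re_nneg_mul_expi (R : realType) (c : R[i]) (a : R) :
  0 <= c -> complex.Re (c * expi a) = complex.Re c * cos a.
Proof. by case: c => x y; rewrite lecE /= => /andP[/eqP -> _]; rewrite mul0r subr0. Qed.

Lemma nneg_poly_root_sector (R : realType) (d : nat) (p : {poly R[i]})
    (r theta : R) :
  p != 0 -> (size p <= d.+1)%N -> p \is a polyOver Num.nneg ->
  0 < r -> `|theta| < pi / d%:R -> ~~ root p (r%:C * expi theta).
Proof.
move=> p_neq0 size_p /polyOverP p_ge0 r_gt0 theta_lt; apply/negP => /rootP.
(* For [d = 0] the quotient [pi / d%:R] is [0] by convention, so the bound on [theta] is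
   contradictory. *)
have d_gt0 : 0 < d%:R :> R.
  rewrite ltr0n lt0n; apply/negP => /eqP d0; move: theta_lt.
  by rewrite d0 invr0 mulr0 normr_lt0.
(* Since [|k - d / 2| <= d / 2], turning by [- theta * d / 2] brings every argument [k * theta]
   strictly between [- pi / 2] and [pi / 2]. *)
have cos_pos (k : 'I_d.+1) : 0 < cos (theta *+ k - theta * d%:R / 2).
  have k_le : k%:R <= d%:R :> R by rewrite ler_nat -ltnS.
  have k_ge0 : 0 <= k%:R :> R by [].
  move: theta_lt; rewrite ltr_pdivlMr // => theta_lt.
  have half_le : `|theta *+ k - theta * d%:R / 2| < pi / 2.
    have -> : theta *+ k - theta * d%:R / 2 = theta * (k%:R - d%:R / 2).
      by rewrite -[theta *+ k]mulr_natr mulrBr mulrA.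
    rewrite normrM.
    apply: (@le_lt_trans _ _ (`|theta| * (d%:R / 2))); last by lra.
    by apply: ler_wpM2l => //; rewrite ler_norml; lra.
  by apply: cos_gt0_pihalf; rewrite -ltr_norml.
have coef_w_ge0 (k : nat) : 0 <= p`_k * (r ^+ k)%:C.
  rewrite mulr_ge0 //; first exact: p_ge0.
  by rewrite lecR exprn_ge0 // ltW.
move=> pw0.
(* This sum is the real part of the vanishing value of [p] after that rotation; the coefficients,
   being real, factor out of the real parts. *)
have : \sum_(k < d.+1) complex.Re (p`_k * (r ^+ k)%:C)
    * cos (theta *+ k - theta * d%:R / 2) = 0.
  transitivity (complex.Re (p.[r%:C * expi theta]
      * expi (- (theta * d%:R / 2)))); last by rewrite pw0 mul0r.
  rewrite (horner_coef_wide _ size_p) mulr_suml raddf_sum.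
  apply: eq_bigr => k _; rewrite exprMn expiX -rmorphXn mulrA -[_ * _ * expi _]mulrA -expiD /=.
  by rewrite Re_nneg_mul_expi.
have term_ge0 (k : 'I_d.+1) : true ->
    0 <= complex.Re (p`_k * (r ^+ k)%:C) * cos (theta *+ k - theta * d%:R / 2).
  move=> _; apply: mulr_ge0; last exact: ltW.
  by move: (coef_w_ge0 k); rewrite lecE => /andP[].
move/(psumr_eq0P term_ge0) => terms0; case/eqP: p_neq0.
apply/polyP => k; rewrite coef0.
have [k_lt|k_ge] := ltnP k d.+1; last first.
  by apply: nth_default; exact: leq_trans k_ge.
have /eqP := terms0 (Ordinal k_lt) isT.
rewrite mulf_eq0 (gt_eqF (cos_pos _)) orbF /= => /eqP Re0.
have /eqP : p`_k * (r ^+ k)%:C = 0.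
  move: (coef_w_ge0 k) Re0; rewrite lecE => /andP[Im0 _] Re0.
  by apply/eqP; rewrite eq_complex Re0 (eqP Im0) !eqxx.
rewrite mulf_eq0 => /orP[/eqP //|].
by rewrite fmorph_eq0 expf_eq0 (gt_eqF r_gt0) andbF.
Qed.

(** At [d - 1 + w] the factor of index [i] is [w + (d - j) + (d - 1 - i)], where [j <= d] and
    [i < d]. *)
Lemma binpoly_shift_nneg (R : realType) (d j : nat) : (j <= d)%N ->
  binpoly R (d%:Z - j%:Z) d \Po ('X + (d%:R - 1)%:P) \is a polyOver Num.nneg.
Proof.
move=> j_le; rewrite /binpoly comp_polyZ rmorph_prod.
apply: polyOverZ; first by rewrite nnegrE invr_ge0 ler0n.
apply: rpred_prod => i _.
have i_lt := ltn_ord i.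
rewrite /= comp_polyD comp_polyX comp_polyC -addrA -polyCD.
rewrite rpredD ?polyOverX // polyOverC nnegrE.
have -> : (d%:R - 1 + (d%:Z - j%:Z - i%:Z)%:~R)
    = ((d - j) + (d - i.+1))%:R :> R[i].
  rewrite natrD !natrB // !intrB -natr1; ring.
exact: ler0n.
Qed.

Lemma binpoly_reflect_nneg (R : realType) (d j : nat) : (j <= d)%N ->
  (-1) ^+ d *: (binpoly R (d%:Z - j%:Z) d \Po (- d%:R%:P - 'X))
    \is a polyOver Num.nneg.
Proof.
move=> j_le; rewrite /binpoly comp_polyZ rmorph_prod scalerA mulrC -scalerA.
apply: polyOverZ; first by rewrite nnegrE invr_ge0 ler0n.
(* The sign is spread over the [d] factors, one [-1] each: the factor of index [i] at [- d - w] is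
   [- (w + j + i)]. *)
rewrite -mul_polyC rmorphXn -[X in _ ^+ X]card_ord -prodr_const -big_split.
apply: rpred_prod => i _.
rewrite /= comp_polyD comp_polyX comp_polyC.
have -> : (-1)%:P * (- d%:R%:P - 'X + (d%:Z - j%:Z - i%:Z)%:~R%:P)
    = 'X + (j + i)%:R%:P :> {poly R[i]}.
  rewrite !intrB !polyCB natrD polyCD polyCN; ring.
by rewrite rpredD ?polyOverX // polyOverC nnegrE ler0n.
Qed.

Lemma nneg_comb_comp (C : numDomainType) (n : nat) (h : 'I_n -> C)
    (b : 'I_n -> {poly C}) (q : {poly C}) (s : C) :
  (forall j, 0 <= h j) ->
  (forall j, s *: (b j \Po q) \is a polyOver Num.nneg) ->
  s *: ((\sum_(j < n) h j *: b j) \Po q) \is a polyOver Num.nneg.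
Proof.
move=> h_ge0 b_nneg; rewrite raddf_sum scaler_sumr.
apply/polyOverP => k; rewrite coef_sum rpred_sum // => j _.
rewrite /= comp_polyZ scalerA mulrC -scalerA coefZ rpredM //; first exact: h_ge0.
by move/polyOverP: (b_nneg j).
Qed.

(** Composition with the degree-one [q] preserves the degree, so [s *: (f \Po q)] is nonzero and has
    no root in the sector. Keeping [q] and [s] general serves both cones. *)
Lemma SNN_comp_root_sector (R : realType) (d : nat) (f q : {poly R[i]})
    (s : R[i]) (r theta : R) :
  SNN d f -> size q = 2 -> s != 0 ->
  (forall j : nat, (j <= d)%N ->
     s *: (binpoly R (d%:Z - j%:Z) d \Po q) \is a polyOver Num.nneg) ->
  0 < r -> `|theta| < pi / d%:R -> ~ root f q.[r%:C * expi theta].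
Proof.
move=> [size_f [h [f_def h_ge0]]] size_q s_neq0 bin_nneg r_gt0 theta_lt fz0.
have size_fq : size (s *: (f \Po q)) = d.+1.
  by rewrite size_scale // size_comp_poly2.
have fq_nneg : s *: (f \Po q) \is a polyOver Num.nneg.
  rewrite f_def; apply: nneg_comb_comp h_ge0 _ => j.
  by apply: bin_nneg; rewrite -ltnS.
have fq_neq0 : s *: (f \Po q) != 0 by rewrite -size_poly_eq0 size_fq.
have size_le : (size (s *: (f \Po q)) <= d.+1)%N by rewrite size_fq.
move: (nneg_poly_root_sector _ _ _ _ _ fq_neq0 size_le fq_nneg r_gt0 theta_lt).
by rewrite rootZ // root_comp fz0.
Qed.

Theorem theorem3p2 (R : realType) (d : nat) (hd : (2 <= d)%N)
    (f : {poly R[i]}) (hf : SNN d f) (z : R[i]) :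
  (cone1 d `|` cone2 d) z -> ~ root f z.
Proof.
case=> -[r [theta [r_gt0 theta_lt ->]]].
(* Here [q] is the translation taking the sector at the origin to [cone1 d], with [s = 1]. *)
- have size_q : size ('X + (d%:R - 1)%:P : {poly R[i]}) = 2 by rewrite size_XaddC.
  rewrite addrC.
  have := @SNN_comp_root_sector R d f _ 1 r theta hf size_q (oner_neq0 _) _
    r_gt0 theta_lt.
  rewrite !hornerE; apply=> j j_le.
  by rewrite scale1r; exact: binpoly_shift_nneg.
(* Here [q] is the point reflection taking the sector to [cone2 d], and [s = (-1) ^+ d] undoes the
   sign it creates. *)
- have size_q : size (- d%:R%:P - 'X : {poly R[i]}) = 2.
    by rewrite -opprD size_polyN addrC size_XaddC.
  have s_neq0 : (-1) ^+ d != 0 :> R[i] by rewrite signr_eq0.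
  have := @SNN_comp_root_sector R d f _ _ r theta hf size_q s_neq0 _
    r_gt0 theta_lt.
  by rewrite !hornerE; apply=> j; exact: binpoly_reflect_nneg.
Qed.
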